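(* There is a countable set $S\subseteq\omega^*$ and a point $p\in\overline{S}$ such that the subspace $(\omega^*\setminus(\overline{S}\setminus S))\cup\{p\}$ of $\omega^*$ contains a lonely point (that is, some point of this subspace is lonely in this subspace, with the subspace topology).
   Context: $\omega^*=\beta\omega\setminus\omega$, where $\omega$ is discrete and $\beta\omega$ is its Čech–Stone compactification (so $\omega^*$ is the space of free ultrafilters on $\omega$ with the Stone topology). $\overline{S}$ is the closure of $S$ in $\omega^*$. A point $p$ is a limit point of a set $A$ if $p\in\overline{A\setminus\{p\}}$. A set is crowded if it has no isolated points in its subspace topology. A point $p$ of a space $Y$ is lonely (in $Y$) if: (i) $p$ is not a limit point of any countable discrete subset of $Y$ (discrete in the subspace topology); (ii) $p$ is a limit point of some countable crowded subset of $Y$; (iii) whenever $p$ is a limit point of two countable subsets of $Y$, it is a limit point of their intersection. *)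

(* Defs.v *)
From HB Require Import structures.
From mathcomp Require Import all_boot all_classical topology.

Set Implicit Arguments.
Unset Strict Implicit.
Unset Printing Implicit Defensive.

Local Open Scope classical_set_scope.

(* The points of the remainder of the Cech-Stone compactification of the
   discrete space nat. *)
Record omega_star := OmegaStar {
  large : set_system nat;
  large_ultra : UltraFilter large;
  large_free : \bigcap_(A in large) A = set0 }.

HB.instance Definition _ := gen_eqMixin omega_star.
HB.instance Definition _ := gen_choiceMixin omega_star.

Definition stone_basic (A : set nat) : set omega_star :=
  [set p | large p A].

Lemma stone_basic_cover : \bigcup_(A in [set: set nat]) stone_basic A = setT.
Proof.
apply/seteqP; split=> // p _; exists setT => //.
by have ? := large_ultra p; exact: filterT.
Qed.

Lemma stone_basic_join (A B : set nat) (p : omega_star) :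
  [set: set nat] A -> [set: set nat] B -> stone_basic A p -> stone_basic B p ->
  exists C, [/\ [set: set nat] C, stone_basic C p &
    stone_basic C `<=` stone_basic A `&` stone_basic B].
Proof.
move=> _ _ pA pB; exists (A `&` B); split=> //.
  by have ? := large_ultra p; exact: filterI.
move=> q qAB; have ? := large_ultra q.
by split; apply: filterS qAB => n [].
Qed.

HB.instance Definition _ := isBaseTopological.Build omega_star
  stone_basic_cover stone_basic_join.

Section LonelyPoints.
Context {T : topologicalType}.
Implicit Types (A B : set T) (p : T).

Definition discrete_subset A := isolated A = A.

Definition crowded A := isolated A = set0.

Definition lonely p :=
  [/\ forall A, countable A -> discrete_subset A -> ~ limit_point A p,
      exists A, [/\ countable A, crowded A & limit_point A p]
    & forall A B, countable A -> countable B ->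
        limit_point A p -> limit_point B p -> limit_point (A `&` B) p].

End LonelyPoints.

(* Main.v *)
Require Import Defs.
From mathcomp Require Import all_boot all_classical topology wochoice.

Set Implicit Arguments.
Unset Strict Implicit.
Unset Printing Implicit Defensive.

Local Open Scope classical_set_scope.

(** The countable set S is a continuous one-to-one image s |-> P s of a
    countable crowded space in which some point s0 is lonely; both p and the
    lonely point are P s0. Two things are needed: a good countable space, and an
    embedding of it that no countable set from outside the closure of S can
    approach.

    The space. On the natural numbers take a Boolean algebra of sets that
    separates points, contains no singleton, and is maximal with these
    properties; it is the clopen base of a crowded topology. Maximality makes a
    set clopen as soon as the set and its complement are both dense in
    themselves ([ultradisconnected_algebra_exists]), so two disjoint
    dense-in-themselves sets have no common limit point
    ([disjoint_crowded_separated]). If every point were a limit of a discrete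
    set, one could grow a tree from a point, each node being the limit of its
    children, and its even and odd levels would be such a pair with a common
    limit. Hence some s0 is not a limit of a discrete set
    ([nondiscrete_point_exists]); every set accumulating at s0 then has a
    dense-in-itself part accumulating at s0, and the sets accumulating at s0
    form a filter ([limit_in_filter]).

    The embedding. Each s gets a filter F s on the integers so that, for every
    set C, the points s with C in F s form an open set. Following Kunen's
    construction of weak P-points, these filters are enlarged along a
    well-order, one sequence V of sets of integers at a time, while an
    independent linked matrix keeps enough freedom. If the finite
    intersections of V are compatible with all the filters and all patterns in
    the matrix rows still free, V is put into every F s together with
    uncountably many sets U c, any n+1 of which have intersection almost
    contained in the n-th finite intersection of V; otherwise a pattern added to
    all filters throws V out of one of them ([settle_step]). Each step spends
    finitely many rows, and a diagonal argument in the style of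
    Koenig's theorem finds a fresh one ([countable_diagonal]). A maximal
    enlargement of the resulting family that keeps the openness condition
    consists of ultrafilters, because the closure of an open set is clopen
    ([ultra_extension]).

    If D is a countable set of free ultrafilters off the closure of S, pick for
    its n-th member d a set that belongs to d and to no P s, and let V n be the
    complement. Were each U c to lie in some member of D, infinitely many of
    these uncountably many sets would lie in a single d, say the n-th one, and
    intersecting n+1 of them would put V n in d
    ([settled_separates]). So P s0 sees only the traces on S of countable sets,
    and it is lonely because s0 is. *)

Local Notation branch := (nat -> bool).

(** * An ultradisconnected topology on a countable set *)

(** A clopen base of a zero-dimensional Hausdorff topology without isolated
    points: a nonempty open set is never a singleton. *)
Definition clopen_algebra (B : set (set nat)) :=
  [/\ B setT, forall b, B b -> B (~` b),
      forall b c, B b -> B c -> B (b `&` c),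
      forall s, ~ B [set s] &
      forall s t, s <> t -> exists b, [/\ B b, b s & ~ b t]].

Definition limit_in (B : set (set nat)) (X : set nat) (s : nat) :=
  forall b, B b -> b s -> exists x, [/\ x <> s, X x & b x].

Definition crowded_in B X := X `<=` limit_in B X.

Definition ultradisconnected B :=
  forall A, crowded_in B A -> crowded_in B (~` A) -> B A.

Definition periodic_sets : set (set nat) :=
  [set b | exists2 m, (0 < m)%N & forall x, b x <-> b (x + m)%N].

(** A starting point for the maximality argument: a nonempty periodic set is
    infinite. *)
Lemma periodic_clopen_algebra : clopen_algebra periodic_sets.
Proof.
have mulp (b : set nat) m k : (forall x, b x <-> b (x + m)%N) ->
    forall x, b x <-> b (x + k * m)%N.
  move=> per; elim: k => [|k IH] x; first by rewrite mul0n addn0.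
  by rewrite mulSn addnA addnAC -per; exact: IH.
split.
- by exists 1%N.
- move=> b [m m0 per]; exists m => // x.
  by rewrite /setC /=; have := per x; tauto.
- move=> b c [m m0 pb] [n n0 pc]; exists (m * n)%N.
    by rewrite muln_gt0 m0.
  move=> x; have := mulp c n m pc x; have := mulp b m n pb x.
  by rewrite (mulnC n) /setI /=; tauto.
- move=> s [m m0 per]; have /per : [set s] s by [].
  move/eqP; rewrite -[X in _ == X]addn0 eqn_add2l => /eqP m00.
  by rewrite m00 in m0.
- move=> s t st; exists [set x | x = s %[mod (s + t).+1]]; split=> //.
    by exists (s + t).+1 => // x; rewrite /= modnDr.
  by rewrite /= !modn_small ?ltnS ?leq_addr ?leq_addl //; exact: nesym.
Qed.

(** If A and its complement are dense in themselves, adjoining A to the algebra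
    creates no singleton, so a maximal algebra already contains A. *)
Lemma ultradisconnected_algebra_exists :
  exists B, clopen_algebra B /\ ultradisconnected B.
Proof.
have := periodic_clopen_algebra; set B0 := periodic_sets => algB0.
(* Adjoining B0 to the members of a chain covers the empty chain as well. *)
have [|X [algX maxX]] :=
  @Zorn_bigcup (set nat) [set X | clopen_algebra (X `|` B0)].
  move=> F FP totF; have [BT BC BI BS Bsep] := algB0.
  have sub X : F X -> X `|` B0 `<=` \bigcup_(X in F) X `|` B0.
    by move=> FX b [Xb|?]; [left; exists X|right].
  split.
  - by right.
  - move=> b [[X FX Xb]|Bb]; last by right; exact: BC.
    have [_ XC _ _ _] := FP X FX.
    by apply: (sub X FX); apply: XC; left.
  - move=> b c [[X FX Xb]|Bb] [[Y FY Yc]|Bc].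
    + have [XY|YX] := totF X Y FX FY.
        have [_ _ YI _ _] := FP Y FY.
        by apply: (sub Y FY); apply: YI; left => //; exact: XY.
      have [_ _ XI _ _] := FP X FX.
      by apply: (sub X FX); apply: XI; left => //; exact: YX.
    + have [_ _ XI _ _] := FP X FX.
      by apply: (sub X FX); apply: XI; [left|right].
    + have [_ _ YI _ _] := FP Y FY.
      by apply: (sub Y FY); apply: YI; [right|left].
    + by right; exact: BI.
  - move=> s [[X FX Xs]|]; last exact: BS.
    by have [_ _ _ XS _] := FP X FX; apply: (XS s); left.
  - by move=> s t /Bsep[b [Bb bs bt]]; exists b; split=> //; right.
exists (X `|` B0); split=> // A pA pA'.
have [BT BC BI BS Bsep] := algX.
(* the Boolean algebra generated by the old one and A *)
set B' := [set d | exists b c, [/\ (X `|` B0) b, (X `|` B0) c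
  & d = (b `&` A) `|` (c `&` ~` A)]].
have BB' : X `|` B0 `<=` B'.
  by move=> b Bb; exists b, b; split=> //; rewrite -setIUr setUCr setIT.
have B'A : B' A.
  exists setT, (~` setT); split=> //; first exact: BC.
  by rewrite setTI setCT set0I setU0.
apply: contrapT => nBA; apply: (maxX B').
  split; last by move=> sB; apply: nBA; left; exact: sB.
  by move=> b Xb; apply: BB'; left.
rewrite /= setUidl; last by move=> b B0b; apply: BB'; right.
split.
- exact: BB'.
- move=> _ [b [c [Bb Bc ->]]]; exists (~` b), (~` c).
  split; [exact: BC|exact: BC|apply/seteqP; split=> x /=].
    case: (pselect (A x)); case: (pselect (b x)); case: (pselect (c x)); tauto.
  by move=> [[nb Ax]|[nc nA]] [[]|[]].
- move=> _ _ [b [c [Bb Bc ->]]] [b' [c' [Bb' Bc' ->]]].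
  exists (b `&` b'), (c `&` c'); split; [exact: BI|exact: BI|].
  by apply/seteqP; split=> x /=; tauto.
- move=> s [b [c [Bb Bc bcs]]].
  have : [set s] s by []. rewrite bcs => -[[bs As]|[cs As]].
    have [x [xs Ax bx]] := pA s As b Bb bs.
    by apply: xs; suff : [set s] x by []; rewrite bcs; left.
  have [x [xs Ax cx]] := pA' s As c Bc cs.
  by apply: xs; suff : [set s] x by []; rewrite bcs; right.
- by move=> s t /Bsep[b [Bb bs bt]]; exists b; split=> //; exact: BB'.
Qed.

Definition open_in (B : set (set nat)) (O : set nat) :=
  forall s, O s -> exists b, [/\ B b, b s & b `<=` O].

Definition relatively_discrete B (X : set nat) :=
  forall s, X s -> ~ limit_in B X s.

Section ClopenAlgebra.
Variable B : set (set nat).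
Hypothesis algB : clopen_algebra B.
Implicit Types X Y O b : set nat.

Lemma clopenT : B setT. Proof. by case: algB. Qed.
Lemma clopenC b : B b -> B (~` b).
Proof. by case: algB => _ + _ _ _; apply. Qed.
Lemma clopenI b c : B b -> B c -> B (b `&` c).
Proof. by case: algB => _ _ + _ _; apply. Qed.

Lemma clopen_separated s t : s <> t -> exists b, [/\ B b, b s & ~ b t].
Proof. by case: algB => _ _ _ _; apply. Qed.

Lemma limit_inT s : limit_in B setT s.
Proof.
move=> b Bb bs; apply: contrapT => nx; case: algB => _ _ _ /(_ s) + _; apply.
suff <- : b = [set s] by [].
apply/seteqP; split=> x /=; last by move->.
by move=> bx; apply: contrapT => xs; apply: nx; exists x.
Qed.

Lemma limit_in_sub X Y s : X `<=` Y -> limit_in B X s -> limit_in B Y s.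
Proof.
move=> XY aX b Bb bs; have [x [xs Xx bx]] := aX b Bb bs.
by exists x; split=> //; exact: XY.
Qed.

Lemma limit_inI X b s :
  B b -> b s -> limit_in B X s -> limit_in B (X `&` b) s.
Proof.
move=> Bb bs aX c Bc cs.
have [x [xs Xx [bx cx]]] := aX _ (clopenI Bb Bc) (conj bs cs).
by exists x.
Qed.

Lemma limit_inU X Y s :
  limit_in B (X `|` Y) s -> limit_in B X s \/ limit_in B Y s.
Proof.
move=> aXY; apply: contrapT => /not_orP[nX nY]; apply: nX => b Bb bs.
apply: contrapT => nx; apply: nY => c Bc cs.
have [x [xs [Xx|Yx] [bx cx]]] := aXY _ (clopenI Bb Bc) (conj bs cs).
  by case: nx; exists x.
by exists x.
Qed.

Lemma limit_in_trans X Y s :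
  Y `<=` X `|` limit_in B X -> limit_in B Y s -> limit_in B X s.
Proof.
move=> YX aY b Bb bs.
have [y [ys Yy yb]] := aY b Bb bs.
have [Xy|aXy] := YX y Yy; first by exists y.
have [c [Bc cy ncs]] := clopen_separated ys.
have [x [xy Xx [bx cx]]] := aXy _ (clopenI Bb Bc) (conj yb cy).
by exists x; split=> // xs; apply: ncs; rewrite -xs.
Qed.

Lemma open_in_crowded O : open_in B O -> crowded_in B O.
Proof.
move=> oO s /oO[b [Bb bs bO]]; apply: limit_in_sub bO _.
rewrite -[b]setTI; apply: limit_inI => //; exact: limit_inT.
Qed.

Hypothesis udB : ultradisconnected B.

(** Extremal disconnectedness: the closure of an open set and its complement
    are both dense in themselves. *)
Lemma closure_open_in O : open_in B O -> B (O `|` limit_in B O).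
Proof.
move=> oO; apply: udB.
  move=> s [/(open_in_crowded oO)|] aO; apply: limit_in_sub aO;
    exact: subsetUl.
apply: open_in_crowded => s /not_orP[nO naO].
apply: contrapT => nb; apply: naO => b Bb bs.
apply: contrapT => nx; apply: nb; exists b; split=> // x bx Ox.
have nOx : ~ O x.
  by move=> Ox'; apply: nx; exists x; split=> // xs; apply: nO; rewrite -xs.
case: Ox => // aO; have [y [_ Oy yb]] := aO b Bb bx.
by apply: nx; exists y; split=> // ys; apply: nO; rewrite -ys.
Qed.

(** The largest dense-in-itself set Z inside the complement of X contains Y, and
    its own complement is dense in itself too: a point isolated there would be a
    limit of Z, hence could be added to Z. So Z is clopen and separates X from
    Y. *)
Lemma disjoint_crowded_separated X Y s : crowded_in B X -> crowded_in B Y ->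
  X `&` Y `<=` set0 -> limit_in B X s -> limit_in B Y s -> False.
Proof.
move=> pX pY XY aX aY.
set Z := [set z | exists Z', [/\ crowded_in B Z', Z' `<=` ~` X & Z' z]].
have pZ : crowded_in B Z.
  move=> z [Z' [pZ' Z'X /pZ']]; apply: limit_in_sub => x Z'x.
  by exists Z'.
have ZX : Z `<=` ~` X by move=> z [Z' [_ + +]]; apply.
have YZ : Y `<=` Z by move=> y Yy; exists Y; split=> // x Yx Xx; exact: (XY x).
have BZ : B Z.
  apply: udB => // t nZt.
  have [Xt|nXt] := pselect (X t).
    by apply: limit_in_sub (pX t Xt) => x Xx /ZX.
  apply: contrapT => naZ; apply: nZt; exists (t |` Z); split; last 2 first.
  - by move=> x [->|/ZX].
  - by left.
  - have := limit_inT (s := t); rewrite -(setUv Z) => /limit_inU[|//] aZ.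
    move=> x [->|Zx].
      by apply: limit_in_sub aZ; exact: subsetUr.
    by apply: limit_in_sub (pZ x Zx); exact: subsetUr.
have [Zs|nZs] := pselect (Z s).
  by have [x [_ Xx /ZX]] := aX Z BZ Zs.
have [y [_ Yy]] := aY _ (clopenC BZ) nZs.
by apply; exact: YZ.
Qed.

Section Tree.
Variable D : nat -> set nat.
Hypothesis Ddiscrete : forall t, relatively_discrete B (D t).
Hypothesis Dacc : forall t, limit_in B (D t) t.

(** Points of a countable discrete set can be given pairwise disjoint clopen
    neighbourhoods: shrink the isolating neighbourhood of each point by removing
    those of the finitely many smaller points. *)
Lemma disjoint_expansion (E : set nat) t : relatively_discrete B E ->
  exists c : nat -> set nat,
    (forall u, E u -> u <> t -> [/\ B (c u), c u u & ~ c u t]) /\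
    (forall u v x, E u -> E v -> c u x -> c v x -> u = v).
Proof.
move=> dE.
have /choice[i iP] u : exists b,
    E u -> [/\ B b, b u & forall x, E x -> b x -> x = u].
  have [Eu|] := pselect (E u); last by exists set0.
  apply: contrapT => nb; apply: (dE u Eu) => b Bb bu.
  apply: contrapT => nx; apply: nb; exists b => _; split=> // x Ex bx.
  by apply: contrapT => xu; apply: nx; exists x.
have /choice[k kP] u : exists b, u <> t -> [/\ B b, b u & ~ b t].
  have [->|/clopen_separated[b ?]] := pselect (u = t); first by exists set0.
  by exists b.
have disj n u : E u -> exists b, [/\ B b, b u &
    forall v x, E v -> (v < n)%N -> v <> u -> b x -> ~ i v x].
  move=> Eu; elim: n => [|n [b [Bb bu bP]]].
    by exists setT; split=> //; exact: clopenT.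
  have [[En nu]|nEn] := pselect (E n /\ n <> u).
    have [Bi _ iu] := iP n En.
    exists (b `&` ~` i n); split=> [|| v x Ev].
    - by apply: clopenI => //; exact: clopenC.
    - by split=> // /(iu _ Eu) /esym.
    - rewrite ltnS leq_eqVlt => /orP[/eqP-> _ []//|vn vu [bx _]].
      exact: bP vn vu bx.
  exists b; split=> // v x Ev; rewrite ltnS leq_eqVlt => /orP[/eqP vn vu|vn vu].
    by case: nEn; rewrite -vn.
  exact: bP.
have /choice[d dP] u : exists b, E u -> [/\ B b, b u &
    forall v x, E v -> (v < u)%N -> v <> u -> b x -> ~ i v x].
  have [Eu|] := pselect (E u); last by exists set0.
  by have [b] := disj u u Eu; exists b.
exists (fun u => i u `&` d u `&` k u); split.
  move=> u Eu ut; have [Bi iu _] := iP u Eu; have [Bd du _] := dP u Eu.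
  have [Bk ku nkt] := kP u ut.
  by split; [exact: clopenI (clopenI _ _) _|by []|move=> []].
suff lt u v x : E u -> E v -> (u < v)%N -> i u x -> d v x -> False.
  move=> u v x Eu Ev [[iu du] _] [[iv dv] _].
  case: (ltngtP u v) => // uv; exfalso; first exact: (lt u v x).
  exact: (lt v u x).
move=> Eu Ev uv iu dv; have [_ _ dd] := dP v Ev.
by apply: (dd u x Eu uv _ dv iu) => uv'; rewrite uv' ltnn in uv.
Qed.

(** If every point t were a limit of a discrete set D t, the points of D t could
    serve as the children of t in a tree rooted at 0. A node carries a clopen
    neighbourhood that contains all its descendants; disjointness of the
    neighbourhoods at one level makes distinct levels disjoint. *)
Lemma tree_contradiction : False.
Proof.
have /choice[c cP] t := @disjoint_expansion (D t) t (@Ddiscrete t).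
pose fix level n : nat -> set nat -> Prop :=
  if n is m.+1 then fun u b => exists t e,
    [/\ level m t e, D t u, u <> t, e u & b = c t u `&` e]
  else fun u b => u = 0%N /\ b = setT.
have lev_in n u b : level n u b -> B b /\ b u.
  elim: n u b => [|n IH] u b /=.
    by move=> [_ ->]; split=> //; exact: clopenT.
  move=> [t [e [/IH[Be _] Dtu ut eu ->]]].
  by have [Bc cu _] := (cP t).1 u Dtu ut; split=> //; exact: clopenI.
have lev_disj n u b u' b' x : level n u b -> level n u' b' -> b x -> b' x ->
    u = u' /\ b = b'.
  elim: n u b u' b' x => [|n IH] u b u' b' x /=.
    by move=> [-> ->] [-> ->].
  move=> [t [e [lt Dtu _ eu ->]]] [t' [e' [lt' Dtu' _ eu' ->]]].
  move=> [cx ex] [cx' ex'].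
  have [tt' ee'] := IH _ _ _ _ x lt lt' ex ex'; subst t' e'.
  by have <- := (cP t).2 _ _ _ Dtu Dtu' cx cx'.
have anc n k u b : level (n + k.+1) u b ->
    exists t e, [/\ level n t e, b `<=` e & ~ b t].
  elim: k u b => [|k IH] u b.
    rewrite addn1 => -[t [e [lt Dtu ut eu ->]]]; exists t, e; split=> //.
    by have [_ _ nct] := (cP t).1 u Dtu ut; case.
  rewrite addnS => -[t [e [/IH[t' [e' [lt' ee' nt']]] Dtu ut eu ->]]].
  exists t', e'; split=> //; first by move=> x [_ /ee'].
  by case.
have lev_neq m n u b b' : (m < n)%N -> level m u b -> level n u b' -> False.
  move=> mn lm ln; have [_ b'u] := lev_in _ _ _ ln.
  move: (ln); rewrite -(subnKC mn) addSnnS => /anc[t [e [lt b'e nbt]]].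
  have [_ bu] := lev_in _ _ _ lm.
  have [tu _] := lev_disj _ _ _ _ _ u lt lm (b'e _ b'u) bu.
  by apply: nbt; rewrite tu.
(* L true and L false are the odd and the even levels of the tree. *)
pose L (r : bool) := [set u | exists n b, odd n = r /\ level n u b].
have acc_next r : L r `<=` limit_in B (L (~~ r)).
  move=> t [n [e [nr lt]]]; have [Be et] := lev_in _ _ _ lt.
  move=> b Bb bt.
  have [u [ut Du [bu eu]]] := @Dacc t _ (clopenI Bb Be) (conj bt et).
  exists u; split=> //; exists n.+1, (c t u `&` e); rewrite /= nr; split=> //.
  by exists t, e.
have perfL r : crowded_in B (L r).
  move=> t /acc_next; apply: limit_in_trans => x /acc_next.
  by rewrite negbK; right.
have L0 : L false 0%N by exists 0%N, setT.
apply: (@disjoint_crowded_separated (L false) (L true) 0%N) => //.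
- move=> u [[m [b [om lm]]] [n [b' [on ln]]]].
  case: (ltngtP m n) => mn; first exact: lev_neq lm ln.
    exact: lev_neq ln lm.
  by rewrite -mn om in on.
- exact: (perfL false _ L0).
- exact: (acc_next false _ L0).
Qed.

End Tree.

Lemma nondiscrete_point_exists : exists s0, forall X,
  relatively_discrete B X -> ~ limit_in B X s0.
Proof.
apply: contrapT => /forallNP nex.
have /choice[D DP] t : exists X, relatively_discrete B X /\ limit_in B X t.
  by move/existsNP: (nex t) => [X /not_implyP[dX /contrapT aX]]; exists X.
by apply: (@tree_contradiction D) => t; case: (DP t).
Qed.

(** Removing from X its largest dense-in-itself subset leaves a scattered set;
    its isolated points are discrete and dense in it, so s0 is not a limit of
    it. *)
Lemma limit_in_kernel s0 X :
  (forall X, relatively_discrete B X -> ~ limit_in B X s0) ->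
  limit_in B X s0 ->
  exists Y, [/\ crowded_in B Y, Y `<=` X & limit_in B Y s0].
Proof.
move=> nd aX.
set K := [set x | exists Y, [/\ crowded_in B Y, Y `<=` X & Y x]].
have pK : crowded_in B K.
  by move=> x [Y [pY YX /pY]]; apply: limit_in_sub => y Yy; exists Y.
have KX : K `<=` X by move=> x [Y [_ + +]]; apply.
exists K; split=> //.
set R := X `\` K.
have : limit_in B (K `|` R) s0.
  by apply: limit_in_sub aX => x Xx; case: (pselect (K x)); [left|right].
case/limit_inU => // aR; exfalso.
apply: (nd [set x | R x /\ ~ limit_in B R x]).
  by move=> x [_ nx] ax; apply: nx; apply: limit_in_sub ax => y [].
apply: limit_in_trans aR => x Rx.
have [aR|] := pselect (limit_in B R x); last by left.
right=> b Bb bx; apply: contrapT => nex.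
have [_] := Rx; apply; exists (R `&` b); split=> //; last by move=> y [[]].
move=> y [Ry yb]; apply: limit_inI => //; apply: contrapT => naR.
by apply: nex; exists y; split=> //; move=> yx; apply: naR; rewrite yx.
Qed.

(** Otherwise, near s0, the dense-in-itself parts of X and Y would be disjoint
    apart from s0, and s0 would be a common limit. *)
Lemma limit_in_filter s0 X Y :
  (forall X, relatively_discrete B X -> ~ limit_in B X s0) ->
  limit_in B X s0 -> limit_in B Y s0 -> limit_in B (X `&` Y) s0.
Proof.
move=> nd /(limit_in_kernel nd)[X' [pX XX aX]].
move=> /(limit_in_kernel nd)[Y' [pY YY aY]].
apply: contrapT => /existsNP[b /not_implyP[Bb /not_implyP[bs nex]]].
have pc (Z : set nat) : crowded_in B Z -> crowded_in B ((Z `&` b) `\ s0).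
  move=> pZ x [[Zx bx] xs]; have [c [Bc cx ncs]] := clopen_separated xs.
  have := limit_inI (clopenI Bb Bc) (conj bx cx) (pZ x Zx).
  apply: limit_in_sub => y [Zy [yb cy]]; split=> // ys.
  by apply: ncs; rewrite -ys.
have ac (Z : set nat) : limit_in B Z s0 -> limit_in B ((Z `&` b) `\ s0) s0.
  move=> aZ c Bc cs.
  have [x [xs Zx [bx cx]]] := aZ _ (clopenI Bb Bc) (conj bs cs).
  by exists x.
apply: (disjoint_crowded_separated (pc _ pX) (pc _ pY) _ (ac _ aX) (ac _ aY)).
move=> x [[[Xx bx] xs] [[Yx _] _]]; apply: nex; exists x; split=> //.
by split; [exact: XX|exact: YY].
Qed.

End ClopenAlgebra.

(** * An independent linked matrix of sets of integers *)

Section Matrix.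

Definition restrict k (i : nat -> bool) : k.-tuple bool := [tuple i j | j < k].

(** Kunen's matrix lives on triples of a level k, a label at most k, and a
    finite set f of pairs of binary words of length k, read as a multivalued
    function. The label is the coordinate [place]; bounding it by k leaves
    finitely many triples per level. *)
Definition finite_code k :=
  ('I_k.+1 * {set k.-tuple bool * k.-tuple bool})%type.

Definition code := {k : nat & finite_code k}.

(** The triple belongs to row i, column c and index n when f sends the first k
    bits of i to at most n words, one of which consists of the first k bits
    of c. *)
Definition linked_matrix (i c : nat -> bool) (n : nat) : set nat :=
  [set x | exists m : code, [/\ pickle m = x,
    (restrict (tag m) i, restrict (tag m) c) \in (tagged m).2 &
    (#|[set y | (restrict (tag m) i, y) \in (tagged m).2]%SET| <= n)%N]].

Definition place (x : nat) : nat :=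
  if @unpickle code x is Some m then (tagged m).1 else 0%N.

Lemma linked_matrix_mono i c m n : (m <= n)%N ->
  linked_matrix i c m `<=` linked_matrix i c n.
Proof.
by move=> mn x [y [yx iy cy]]; exists y; split=> //; exact: leq_trans cy mn.
Qed.

Lemma restrict_separates (l : seq branch) :
  exists k0, forall k, (k0 <= k)%N -> {in l &, injective (restrict k)}.
Proof.
have sep2 (c d : nat -> bool) : exists k0, forall k, (k0 <= k)%N ->
    restrict k c = restrict k d -> c = d.
  have [->|/eqP cd] := pselect (c = d); first by exists 0%N.
  have [j cdj] : exists j, c j <> d j.
    apply: contrapT => /forallNP h; move/eqP: cd; apply.
    by apply/funext => j; apply: contrapT.
  exists j.+1 => k jk /(congr1 (fun t => tnth t (Ordinal jk))).
  by rewrite !tnth_mktuple.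
have /choice[h hP] (p : branch * branch) : exists k0,
    forall k, (k0 <= k)%N ->
    restrict k p.1 = restrict k p.2 -> p.1 = p.2 by exact: sep2.
exists (\max_(p <- [seq (c, d) | c <- l, d <- l]) h p)%N => k hk c d cl dl.
apply: (hP (c, d)); apply: leq_trans hk; apply: leq_bigmax_seq => //.
exact: allpairs_f.
Qed.

(** At a level high enough to tell the n+1 columns apart, f would take more than
    n values at the row. *)
Lemma linked_matrix_finite i (l : seq branch) n : uniq l -> (n < size l)%N ->
  finite_set [set x | forall c, c \in l -> linked_matrix i c n x].
Proof.
move=> ul nl; have [k0 inj] := restrict_separates l.
apply: (@sub_finite_set _ _
  (\bigcup_(k in `I_k0)
    ((fun m : finite_code k => pickle (Tagged finite_code m : code)) @` setT))).
  move=> x /= xl; case: l ul nl inj xl => [//|c0 l] ul nl inj xl.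
  have [m [mx _ cm]] := xl c0 (mem_head _ _).
  have ml c : c \in c0 :: l ->
      (restrict (tag m) i, restrict (tag m) c) \in (tagged m).2.
    by move=> /xl[m' [+ im' _]]; rewrite -mx => /(pcan_inj pickleK) <-.
  case: (ltnP (tag m) k0) => km.
    by exists (tag m) => //; exists (tagged m) => //; rewrite -mx; case: (m).
  move: cm; rewrite leqNgt => /negP; case; apply: leq_trans nl _.
  have umap : uniq (map (restrict (tag m)) (c0 :: l)).
    by rewrite map_inj_in_uniq //; exact: inj.
  rewrite -(size_map (restrict (tag m))) -(card_uniqP umap).
  apply/subset_leq_card/fintype.subsetP => _ /mapP[c cl ->].
  by rewrite inE ml.
apply: bigcup_finite => // k _; apply: finite_image; exact: finite_finset.
Qed.

(** At a level high enough to tell the rows apart, let f send each row to the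
    finite list of its chosen columns. *)
Lemma linked_matrix_independent (rs : seq branch) (l : branch -> seq branch)
    j :
  infinite_set [set x | place x = j /\
    forall i c, i \in rs -> c \in l i -> linked_matrix i c (size (l i)) x].
Proof.
have [k0 inj] := restrict_separates rs.
pose f k := [set p : k.-tuple bool * k.-tuple bool |
  has (fun i => has (fun c => p == (restrict k i, restrict k c)) (l i)) rs]%SET.
pose g n := pickle
  (Tagged finite_code (@inord (k0 + j + n) j, f (k0 + j + n)%N) : code).
have ginj : injective g.
  by move=> m n /(pcan_inj pickleK) /(congr1 tag) /= /addnI.
apply: (@sub_infinite_set _ (range g)).
  move=> _ [n _ <-] /=; split.
    by rewrite /place /g pickleK /= inordK // ltnS -addnA addnCA leq_addr.
  move=> i c irs cl; eexists; split; first by [].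
    by rewrite /= inE; apply/hasP; exists i => //; apply/hasP; exists c.
  rewrite /=; set k := (k0 + j + n)%N.
  apply: (@leq_trans #|map (restrict k) (l i)|); last first.
    by apply: leq_trans (card_size _) _; rewrite size_map.
  apply/subset_leq_card/fintype.subsetP => y; rewrite !inE.
  move=> /hasP[i' i'rs /hasP[c' c'l]].
  move=> /eqP/pair_equal_spec[ii' ->]; apply/map_f.
  have k0k : (k0 <= k)%N by rewrite /k -addnA leq_addr.
  by rewrite (inj k k0k i i' irs i'rs ii').
move=> fin; apply: infinite_nat.
have := finite_preimage (in2W ginj) fin.
by apply: sub_finite_set => n _; exists n.
Qed.

End Matrix.

(** * Tools for the transfinite construction *)

(** Bookkeeping without cardinal arithmetic: all of T is enumerated by g along a
    well-ordered set D each of whose proper initial segments is too small to be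
    mapped onto T. If some initial segment of a well-order of T is mapped onto
    T, take for D the least such one. *)
Lemma short_well_order (T : eqType) :
  exists (lt : T -> T -> Prop) (D : set T) (g : T -> T),
  [/\ well_founded lt, (forall x y z, lt x y -> lt y z -> lt x z),
     (forall x y, x <> y -> lt x y \/ lt y x),
     (forall u t, D t -> lt u t -> D u) &
     (forall k, exists2 t, D t & g t = k) /\
     (forall t, D t -> forall h : T -> T,
       exists y, forall u, lt u t -> h u <> y)].
Proof.
have [R woR] := well_ordering_principle T.
have least (A : set T) : A !=set0 -> exists2 z, A z & forall x, A x -> R z x.
  move=> [a Aa]; have [|z [[zA lb] _]] := woR (fun x => `[< A x >]).
    by exists a; exact/asboolP.
  by exists z => [|x Ax]; [exact/asboolP|apply: lb; exact/asboolP].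
have total x y : R x y \/ R y x.
  have [|z [->|->] lb] := least [set z | z = x \/ z = y].
  - by exists x; left.
  - by left; apply: lb; right.
  - by right; apply: lb; left.
have anti x y : R x y -> R y x -> x = y.
  move=> Rxy Ryx.
  have [z [_ uz]] := woR (fun z => (z == x) || (z == y))
    (ex_intro _ x (predU1l _ (erefl x))).
  have refl z' : R z' z' by case: (total z' z').
  by transitivity z; [symmetry|]; apply: uz; split;
    rewrite ?inE ?unfold_in ?eqxx ?orbT // => w;
    rewrite unfold_in => /orP[]/eqP->.
pose lt x y := R x y /\ x <> y.
have ltW x y : ~ lt x y -> R y x.
  case: (total x y) => // Rxy nlt; have [->|xy] := pselect (x = y).
    by case: (total y y).
  by case: nlt.
have wf : well_founded lt.
  move=> x; apply: contrapT => nx.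
  have [|z nz lb] := least [set z | ~ Acc lt z]; first by exists x.
  apply: nz; constructor => y [Ryz yz]; apply: contrapT => /lb Rzy.
  exact/yz/anti.
have trans x y z : lt x y -> lt y z -> lt x z.
  move=> [Rxy xy] [Ryz yz].
  have [|w ww lb] := least [set w | [\/ w = x, w = y | w = z]].
    by exists x; constructor 1.
  case: ww => ww; subst w.
  - split; first by apply: lb; constructor 3.
    by move=> xz; subst z; apply: xy; apply: anti.
  - by case: xy; apply: anti => //; apply: lb; constructor 1.
  - by case: yz; apply: anti => //; apply: lb; constructor 2.
have tot x y : x <> y -> lt x y \/ lt y x.
  by move=> xy; case: (total x y) => ?; [left|right]; split=> //; apply: nesym.
pose long t := exists h : T -> T, forall y, exists2 u, lt u t & h u = y.
have short t : ~ long t ->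
    forall h : T -> T, exists y, forall u, lt u t -> h u <> y.
  move=> nl h; apply: contrapT => nex; apply: nl; exists h => y.
  apply: contrapT => nu; apply: nex; exists y => u ut hu.
  by apply: nu; exists u.
have [nl|/contrapT [t0' lt0']] := pselect (~ exists t, long t).
  exists lt, setT, id; split=> //; split; first by move=> k; exists k.
  by move=> t _; apply: short => lt'; apply: nl; exists t.
have [|t0 [g gP] lb] := least long; first by exists t0'.
exists lt, [set u | lt u t0], g; split=> //.
  by move=> u t /= /[swap]; exact: trans.
split=> // t [Rt tt0]; apply: short => /lb Rt0.
exact/tt0/anti.
Qed.

(** The value at t is computed from the graph of G below t. *)
Lemma wf_recursion (T A : Type) (lt : T -> T -> Prop)
    (Phi : T -> (T -> A -> Prop) -> A) : well_founded lt ->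
  exists G : T -> A, forall t, G t = Phi t (fun u a => lt u t /\ a = G u).
Proof.
move=> wf.
pose step t (rec : forall u, lt u t -> A) : A :=
  Phi t (fun u a => exists h : lt u t, a = rec u h).
exists (Fix wf (fun=> A) step) => t; rewrite Fix_eq; last first.
  move=> x f g fg; rewrite /step; congr Phi.
  apply/funext => u; apply/funext => a.
  by apply/propext; split=> -[h ->]; exists h.
rewrite /step; congr Phi; apply/funext => u; apply/funext => a.
by apply/propext; split=> [[h ->]|[h ->]]; [split|exists h].
Qed.

(** Koenig's diagonal argument: T codes sequences of elements of T, and a
    segment that cannot be mapped onto T cannot be mapped onto it by countably
    many maps either, as one sees coordinate by coordinate. *)
Lemma countable_diagonal (T : eqType) (lt : T -> T -> Prop) (t : T)
    (phi : nat -> T -> T) (psi : (nat -> T) -> T) (N : T -> seq T) :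
  (forall c n, phi n (psi c) = c n) ->
  (forall h : T -> T, exists y, forall u, lt u t -> h u <> y) ->
  exists y, forall u, lt u t -> y \notin N u.
Proof.
move=> phipsi short.
have /choice[c cP] n := short (fun u => phi n (nth t (N u) n)).
exists (psi c) => u ut; apply/negP => /nthP -/(_ t)[n _ e].
by apply: (cP n u ut); rewrite e phipsi.
Qed.

(** * Open families of filters *)

Section Families.
Variable B : set (set nat).
Hypothesis algB : clopen_algebra B.
Implicit Types (F : nat -> set (set nat)) (J : set branch).

(** Filters indexed by the points of the space, converging to them along
    [place] and containing the cofinite sets. Openness in the last clause says
    that the closed set of ultrafilters above F s depends upper
    semicontinuously on s; for ultrafilters it is continuity of s |-> F s. *)
Definition open_filters F :=
  [/\ forall s C C', C `<=` C' -> F s C -> F s C',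
      forall s C C', F s C -> F s C' -> F s (C `&` C'),
      forall s b, B b -> b s -> F s (place @^-1` b),
      forall s C, finite_set C -> F s (~` C) &
      forall C, open_in B [set s | F s C]].

(** The index used in row i is the number of columns chosen there, which is the
    case covered by independence of the matrix. *)
Definition pattern (rs : seq branch) (l : branch -> seq branch) :=
  [set x | forall i c,
    i \in rs -> c \in l i -> linked_matrix i c (size (l i)) x].

(** J is the set of rows already spent. *)
Definition independent F J := forall s C rs l, F s C ->
  (forall i, i \in rs -> ~ J i) -> C `&` pattern rs l !=set0.

Definition proper_family F := forall s C, F s C -> C !=set0.

Lemma independent_proper F J : independent F J -> proper_family F.
Proof.
move=> iF s C FC; have [//|x [Cx _]] := iF s C [::] (fun=> [::]) FC.
by exists x.
Qed.

Definition base_family : nat -> set (set nat) := fun s C =>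
  exists b, [/\ B b, b s & finite_set (place @^-1` b `\` C)].

Lemma base_open_filters : open_filters base_family.
Proof.
split.
- move=> s C C' CC [b [Bb bs fC]]; exists b; split=> //.
  by apply: sub_finite_set fC => x [bx nCx]; split=> // /CC.
- move=> s C C' [b [Bb bs fC]] [b' [Bb' bs' fC']].
  exists (b `&` b'); split=> //.
    exact: clopenI.
  apply: (@sub_finite_set _ _
    ((place @^-1` b `\` C) `|` (place @^-1` b' `\` C'))).
    move=> x [[bx b'x] /not_andP[nC|nC]]; by [left|right].
  by rewrite finite_setU.
- by move=> s b Bb bs; exists b; split=> //; rewrite setDv.
- move=> s C fC; exists setT; split=> //; first exact: clopenT.
  by apply: sub_finite_set fC => x [_ /contrapT].
- by move=> C s [b [Bb bs fC]]; exists b; split=> // t bt; exists b.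
Qed.

Lemma base_independent : independent base_family set0.
Proof.
move=> s C rs l [b [Bb bs fC]] _; apply: contrapT => nx.
apply: (@linked_matrix_independent rs l s).
apply: sub_finite_set fC => x [px mx].
by split; [rewrite /= px|move=> Cx; apply: nx; exists x].
Qed.

Lemma directed_union (I : Type) (P : set I) (Ff : I -> nat -> set (set nat)) :
  P !=set0 ->
  (forall i, P i -> open_filters (Ff i)) ->
  (forall i j, P i -> P j -> exists k, [/\ P k,
     forall s, Ff i s `<=` Ff k s & forall s, Ff j s `<=` Ff k s]) ->
  open_filters (fun s C => exists2 i, P i & Ff i s C).
Proof.
move=> [i0 Pi0] oF dir; split.
- move=> s C C' CC [i Pi FC]; exists i => //.
  by have [up _ _ _ _] := oF i Pi; exact: up CC FC.
- move=> s C C' [i Pi FC] [j Pj FC']; have [k [Pk ik jk]] := dir i j Pi Pj.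
  exists k => //; have [_ cap _ _ _] := oF k Pk.
  by apply: cap; [exact: ik|exact: jk].
- by move=> s b Bb bs; exists i0 => //; have [_ _ + _ _] := oF i0 Pi0; apply.
- by move=> s C fC; exists i0 => //; have [_ _ _ + _] := oF i0 Pi0; apply.
- move=> C s [i Pi FC]; have [_ _ _ _ op] := oF i Pi.
  by have [b [Bb bs bC]] := op C s FC; exists b; split=> // t /bC; exists i.
Qed.

Definition meet (V : nat -> set nat) n :=
  [set x | forall m, (m <= n)%N -> V m x].

(** The first alternative is Kunen's condition for the filter common to all
    F s to be OK with respect to V; it makes V harmless. In the second one, V
    never enters the common filter of a larger proper family. *)
Definition settled (V : nat -> set nat) F :=
  (exists U : branch -> set nat,
     (forall c s, F s (U c)) /\
     forall n (l : seq branch), uniq l -> (n < size l)%N ->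
       finite_set ([set x | forall c, c \in l -> U c x] `\` meet V n)) \/
  exists s n, F s (~` meet V n).

Lemma settled_sub V F F' :
  (forall s, F s `<=` F' s) -> settled V F -> settled V F'.
Proof.
move=> FF [[U [FU link]]|[s [n Fn]]]; last by right; exists s, n; exact: FF.
by left; exists U; split=> // c s; exact: FF.
Qed.

Lemma meet_mono V m n : (m <= n)%N -> meet V n `<=` meet V m.
Proof. by move=> mn x Vx k km; apply: Vx; exact: leq_trans km mn. Qed.

(** Adding the offending pattern to every filter, and spending its rows, forces
    the complement of a finite intersection of V into F s. *)
Lemma exclude_step F J V s n C rs l : open_filters F -> independent F J ->
  F s C -> (forall i, i \in rs -> ~ J i) ->
  ~ (C `&` meet V n `&` pattern rs l !=set0) ->
  exists F', [/\ open_filters F', independent F' (J `|` [set i | i \in rs]),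
    forall s, F s `<=` F' s & settled V F'].
Proof.
move=> [up cap base fin op] iF FC rsJ nex.
exists (fun t C' => F t (C' `|` ~` pattern rs l)).
have sub t : F t `<=` [set C' | F t (C' `|` ~` pattern rs l)].
  by move=> C'; apply: up; exact: subsetUl.
split=> //.
- split.
  + by move=> t C1 C2 CC; apply: up; exact: setSU.
  + by move=> t C1 C2 F1 F2; rewrite setUIl; exact: cap.
  + by move=> t b Bb bt; apply: sub; exact: base.
  + by move=> t C1 fC; apply: sub; exact: fin.
  + by move=> C1; exact: op.
- move=> t C1 rs' l' FC1 rsJ'.
  pose l2 i := if i \in rs then l i else l' i.
  have [|x [xC xl]] := iF t _ (rs ++ rs') l2 FC1.
    move=> i; rewrite mem_cat => /orP[/rsJ//|/rsJ' nJ Ji].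
    by apply: nJ; left.
  have xp : pattern rs l x.
    move=> i c irs cl; have := xl i c; rewrite /l2 irs mem_cat irs.
    by apply.
  exists x; split; first by case: xC.
  move=> i c irs cl; have nrs : (i \in rs) = false.
    by apply/negP => irs'; apply: (rsJ' i irs); right.
  by have := xl i c; rewrite /l2 nrs mem_cat irs orbT; apply.
- right; exists s, n; apply: up FC => x Cx.
  have [Vx|] := pselect (meet V n x); last by left.
  by right=> px; apply: nex; exists x.
Qed.

(** The set U c is the union over n of the n-th finite intersection of V and the
    n-th entry of column c in the fresh row y. A point of n+1 such sets outside
    the n-th intersection of V comes from entries of index at most n, so it lies
    in an intersection of n+1 linked sets, which is finite. *)
Lemma include_step F J V y : open_filters F -> independent F J -> ~ J y ->
  (forall s n C rs l, F s C -> (forall i, i \in rs -> ~ J i) ->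
     C `&` meet V n `&` pattern rs l !=set0) ->
  exists F', [/\ open_filters F', independent F' (J `|` [set i | i \in [:: y]]),
    forall s, F s `<=` F' s & settled V F'].
Proof.
move=> [up cap base fin op] iF nJy iV.
pose U c := [set x | exists n, meet V n x /\ linked_matrix y c n x].
pose W n (l : seq branch) :=
  meet V n `&` [set x | forall c, c \in l -> U c x].
exists (fun t C' => exists C n l, F t C /\ C `&` W n l `<=` C').
have sub t : F t `<=` [set C' | exists C n l, F t C /\ C `&` W n l `<=` C'].
  by move=> C FC; exists C, 0%N, [::]; split=> // x [].
split=> //.
- split.
  + move=> t C1 C2 CC [C [n [l [FC CW]]]]; exists C, n, l; split=> //.
    exact: subset_trans CC.
  + move=> t C1 C2 [C [n [l [FC CW]]]] [C' [n' [l' [FC' CW']]]].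
    exists (C `&` C'), (maxn n n'), (l ++ l'); split; first exact: cap.
    move=> x [[Cx C'x] [Vx Ux]]; split.
      apply: CW; split=> //; split; first exact: meet_mono (leq_maxl _ _) _ Vx.
      by move=> c cl; apply: Ux; rewrite mem_cat cl.
    apply: CW'; split=> //; split; first exact: meet_mono (leq_maxr _ _) _ Vx.
    by move=> c cl; apply: Ux; rewrite mem_cat cl orbT.
  + by move=> t b Bb bt; apply: sub; exact: base.
  + by move=> t C1 fC; apply: sub; exact: fin.
  + move=> C1 t [C [n [l [FC CW]]]]; have [b [Bb bt bF]] := op C t FC.
    by exists b; split=> // u /bF FuC; exists C, n, l.
- move=> t C1 rs l' [C [n [l [FC CW]]]] rsJ'.
  have yrs : (y \in rs) = false.
    by apply/negP => yrs; apply: (rsJ' y yrs); right; rewrite /= inE.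
  (* U c contains the entry whose index is the length of l. *)
  pose l2 i := if i == y then l else l' i.
  have [|x [[Cx Vx] xl]] := iV t (maxn n (size l)) C (y :: rs) l2 FC.
    move=> i; rewrite inE => /orP[/eqP->//|/rsJ' nJ Ji].
    by apply: nJ; left.
  exists x; split.
    apply: CW; split=> //; split; first exact: meet_mono (leq_maxl _ _) _ Vx.
    move=> c cl; exists (size l); split.
      exact: meet_mono (leq_maxr _ _) _ Vx.
    by have := xl y c; rewrite /l2 eqxx mem_head; apply.
  move=> i c irs cl; have iy : (i == y) = false.
    by apply/eqP => iy; rewrite -iy irs in yrs.
  by have := xl i c; rewrite /l2 iy inE irs orbT; apply.
- left; exists U; split.
    move=> c s; exists setT, 0%N, [:: c]; split; last first.
      by move=> x [_ [_]]; apply; rewrite mem_head.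
    by have := fin s set0 (finite_set0 _); rewrite setC0.
  move=> n l ul nl; apply: sub_finite_set (linked_matrix_finite y ul nl).
  move=> x [xU nV] c cl; have [m [Vm mc]] := xU c cl.
  have [mn|nm] := leqP m n; first exact: linked_matrix_mono mn _ mc.
  by case: nV; exact: meet_mono (ltnW nm) _ Vm.
Qed.

Lemma settle_step F J V : open_filters F -> independent F J ->
  (exists y, ~ J y) ->
  exists F' (N : seq branch), [/\ open_filters F',
    independent F' (J `|` [set i | i \in N]),
    forall s, F s `<=` F' s & settled V F'].
Proof.
move=> oF iF [y nJy].
have [[s [n [C [rs [l [FC [rsJ nex]]]]]]]|all] := pselect (exists s n C rs l,
  F s C /\ ((forall i, i \in rs -> ~ J i) /\
  ~ (C `&` meet V n `&` pattern rs l !=set0))).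
  by have [F' ?] := exclude_step oF iF FC rsJ nex; exists F', rs.
have [|F' ?] := @include_step F J V y oF iF nJy; last by exists F', [:: y].
move=> s n C rs l FC rsJ; apply: contrapT => nex; apply: all.
by exists s, n, C, rs, l.
Qed.

Definition sequence_of (k : nat -> bool) : nat -> set nat :=
  fun n => [set x | k (pickle (n, x))].

Lemma sequence_of_surj V : exists k, sequence_of k = V.
Proof.
exists (fun z => if @unpickle (nat * nat)%type z is Some p
  then `[< V p.1 p.2 >] else false).
apply/funext => n; apply/funext => x; rewrite /sequence_of /= pickleK /=.
by rewrite asboolE.
Qed.

(** All sequences are settled one after another; at each stage the rows spent so
    far are listed by finite lists along a short initial segment. *)
Lemma settling_family_exists : exists F,
  [/\ open_filters F, proper_family F & forall V, settled V F].
Proof.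
have [lt [D [g [wf trans tot down [gsurj short]]]]] :=
  short_well_order branch.
pose state := ((nat -> set (set nat)) * seq branch)%type.
have /choice[step stepP]
    (a : (nat -> set (set nat)) * set branch * (nat -> set nat)) :
    exists r : state, open_filters a.1.1 -> independent a.1.1 a.1.2 ->
      (exists y, ~ a.1.2 y) ->
      [/\ open_filters r.1, independent r.1 (a.1.2 `|` [set i | i \in r.2]),
        forall s, a.1.1 s `<=` r.1 s & settled a.2 r.1].
  have [h|h] := pselect [/\ open_filters a.1.1, independent a.1.1 a.1.2 &
      exists y, ~ a.1.2 y].
    have [oF iF ex] := h; have [F' [N FN]] := settle_step a.2 oF iF ex.
    by exists (F', N).
  by exists (a.1.1, [::]) => oF iF ex; case: h.
(* the union of the stages already built, and the rows they have spent *)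
pose before (rec : branch -> state -> Prop) : nat -> set (set nat) :=
  fun s C => base_family s C \/ exists u r, rec u r /\ r.1 s C.
pose used (rec : branch -> state -> Prop) : set branch :=
  [set i | exists u r, rec u r /\ i \in r.2].
have [G GE] := @wf_recursion _ _ lt
  (fun t rec => step (before rec, used rec, sequence_of (g t))) wf.
pose fam (o : option branch) :=
  if o is Some u then (G u).1 else base_family.
pose J t := [set i | exists2 u, lt u t & i \in (G u).2].
pose inv t := [/\ open_filters (G t).1,
  independent (G t).1 (J t `|` [set i | i \in (G t).2]),
  forall s, base_family s `<=` (G t).1 s,
  forall u, lt u t -> forall s, (G u).1 s `<=` (G t).1 s &
  settled (sequence_of (g t)) (G t).1].
have unionP (P : set branch) : (forall u, P u -> inv u) ->
    open_filters (fun s C =>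
      exists2 o, (if o is Some u then P u else True) & fam o s C).
  move=> Pinv; apply: directed_union; first by exists None.
    by move=> [u /Pinv[]|_] //; exact: base_open_filters.
  move=> [u|] [v|] Pu Pv.
  - have [<-|/tot[uv|vu]] := pselect (u = v).
    + by exists (Some u); split=> // s C.
    + exists (Some v); split=> // s C //.
      by have [_ _ _ h _] := Pinv v Pv; exact: h u uv s C.
    + exists (Some u); split=> // s C //.
      by have [_ _ _ h _] := Pinv u Pu; exact: h v vu s C.
  - exists (Some u); split=> // s C //; have [_ _ h _ _] := Pinv u Pu; exact: h.
  - exists (Some v); split=> // s C //; have [_ _ h _ _] := Pinv v Pv; exact: h.
  - by exists None; split=> // s C.
have invP t : D t -> inv t.
  elim/(well_founded_ind wf): t => t IH Dt.
  set rec := fun u a => lt u t /\ a = G u.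
  have beforeE : before rec =
      (fun s C =>
        exists2 o, (if o is Some u then lt u t else True) & fam o s C).
    apply/funext => s; apply/funext => C; apply/propext; split.
      move=> [b|[u [_ [[ut ->] FC]]]]; first by exists None.
      by exists (Some u).
    move=> [[u|] ut FC]; last by left.
    by right; exists u, (G u).
  have usedE : used rec = J t.
    apply/funext => i; apply/propext; split.
      by move=> [u [_ [[ut ->] iN]]]; exists u.
    by move=> [u ut iN]; exists u, (G u).
  have IH' u : lt u t -> inv u by move=> ut; apply: IH => //; exact: down ut.
  have oF : open_filters (before rec) by rewrite beforeE; exact: unionP.
  have iF : independent (before rec) (J t).
    rewrite beforeE => s C rs l [[u|] ut FC] rsJ.
      have [_ iu _ _ _] := IH' u ut; apply: iu FC _ => i /rsJ nJ [[v vu iv]|iu].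
        by apply: nJ; exists v => //; exact: trans vu ut.
      by apply: nJ; exists u.
    by apply: base_independent FC _ => i _ [].
  have ex : exists y, ~ J t y.
    have [|y yP] := @countable_diagonal _ lt t
      (fun n k x => k (pickle (n, x)))
      (fun c z => if @unpickle (nat * nat)%type z is Some p
        then c p.1 p.2 else false)
      (fun u => (G u).2) _ (short t Dt).
      by move=> c n; apply/funext => x; rewrite pickleK.
    by exists y => -[u /yP/negP].
  have := stepP (before rec, used rec, sequence_of (g t)) oF.
  rewrite /= usedE => /(_ iF ex); rewrite -usedE -GE usedE => -[oG iG sub sett].
  split=> //.
    by move=> s C bC; apply: sub; left.
  by move=> u ut s C GC; apply: sub; right; exists u, (G u).
exists (fun s C => exists2 o, (if o is Some u then D u else True) & fam o s C).
split.
- by apply: unionP => u; exact: invP.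
- move=> s C [[u|] Du].
    by have [_ + _ _ _] := invP u Du; move/independent_proper; apply.
  exact: (independent_proper base_independent).
- move=> V; have [k <-] := sequence_of_surj V; have [t Dt <-] := gsurj k.
  have [_ _ _ _] := invP t Dt; apply: settled_sub => s C GC.
  by exists (Some t).
Qed.

Hypothesis udB : ultradisconnected B.

(** In a maximal proper open family, let cl be the closure of the open set of
    points s with A in F s. It is clopen, so adding A to F s on cl and the
    complement of A off cl keeps openness. It keeps properness: on cl the
    complement of A cannot be in F s, since by openness it would then be in
    F u for some u close to s with A in F u. Off cl, A is not in F s. *)
Lemma ultra_extension F0 : open_filters F0 -> proper_family F0 ->
  exists F, [/\ open_filters F, proper_family F, forall s, F0 s `<=` F s &
    forall s A, F s A \/ F s (~` A)].
Proof.
move=> oF0 pF0.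
pose fam (X : set (nat * set nat)) s C := X (s, C) \/ F0 s C.
have [|X [[oF pF] maxX]] := @Zorn_bigcup (nat * set nat)%type
    [set X | open_filters (fam X) /\ proper_family (fam X)].
  move=> Z ZP totZ.
  pose famo (o : option (set (nat * set nat))) :=
    if o is Some X then fam X else F0.
  rewrite /=; have -> : fam (\bigcup_(X in Z) X) =
      (fun s C => exists2 o, (if o is Some X then Z X else True) & famo o s C).
    apply/funext => s; apply/funext => C; apply/propext; split.
      by move=> [[X ZX XC]|FC]; [exists (Some X) => //; left|exists None].
    by move=> [[X ZX [XC|FC]|_ FC]]; [left; exists X|right|right].
  split; last by move=> s C [[X /ZP[_ +]|] //=]; [apply|move=> _; exact: pF0].
  apply: directed_union; first by exists None.
    by move=> [X /ZP[]|].
  have famS (X Y : set (nat * set nat)) :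
      X `<=` Y -> forall s, fam X s `<=` fam Y s.
    by move=> XY s C [/XY|]; [left|right].
  have F0S X s : F0 s `<=` fam X s by move=> C; right.
  move=> [X|] [Y|] ZX ZY.
  - have [XY|YX] := totZ X Y ZX ZY.
      by exists (Some Y); split=> //; [exact: famS|move=> s C].
    by exists (Some X); split=> //; [move=> s C|exact: famS].
  - by exists (Some X); split=> //; [move=> s C|exact: F0S].
  - by exists (Some Y); split=> //; [exact: F0S|move=> s C].
  - by exists None; split=> // s C.
exists (fam X); split=> //; first by move=> s C; right.
move=> s0 A; have [up cap base fin op] := oF.
set F := fam X.
set cl := [set s | F s A] `|` limit_in B [set s | F s A].
have Bcl : B cl by exact: closure_open_in.
(* the set added to F s: A on cl and its complement off cl *)
pose extra s := [set x | cl s <-> A x].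
pose F' s := [set C | F s (C `|` ~` extra s)].
have FF' s : F s `<=` F' s by move=> C; apply: up; exact: subsetUl.
have pF' : proper_family F'.
  move=> s C F'C; apply: contrapT => nC; have C0 : C = set0.
    by apply/seteqP; split=> x //= Cx; case: nC; exists x.
  rewrite {}C0 /F' /= set0U in F'C.
  have [cs|ncs] := pselect (cl s); last first.
    apply: (ncs); left; apply: up F'C => x nex; apply: contrapT => nA.
    by apply: nex; split=> // cs; case: ncs.
  have FnA : F s (~` A) by apply: up F'C => x nex Ax; apply: nex.
  have clash u : F u A -> F u (~` A) -> False.
    move=> FA FnA'; have := pF u _ (cap _ _ _ FA FnA').
    by rewrite setICr => -[].
  case: cs => [FA|aA]; first exact: clash FA FnA.
  have [b [Bb bs bF]] := op _ _ FnA.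
  by have [u [_ FA /bF]] := aA b Bb bs; exact: clash.
have oF' : open_filters F'.
  split.
  - by move=> s C C' CC; apply: up; exact: setSU.
  - by move=> s C C' F1 F2; rewrite /F' /= setUIl; exact: cap.
  - by move=> s b Bb bs; apply: FF'; exact: base.
  - by move=> s C fC; apply: FF'; exact: fin.
  - move=> C s F'C; have [b [Bb bs bF]] := op _ _ F'C.
    have [cs|ncs] := pselect (cl s).
      exists (b `&` cl); split=> //; first exact: clopenI.
      move=> u [/bF Fu cu]; apply: up Fu => x [|nx]; first by left.
      by right=> ex; apply: nx; split=> // _; apply/ex.
    exists (b `&` ~` cl); split=> //.
      by apply: clopenI => //; exact: clopenC.
    move=> u [/bF Fu ncu]; apply: up Fu => x [|nx]; first by left.
    by right=> ex; apply: nx; split=> // /ex.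
pose X' : set (nat * set nat) := [set p | F' p.1 p.2].
have famX' : fam X' = F'.
  apply/funext => s; apply/funext => C; apply/propext; split; last by left.
  by move=> [//|F0C]; apply: FF'; right.
have XX' : X `<=` X' by move=> [s C] XC; apply: FF'; left.
have sub' : X' `<=` X.
  apply: contrapT => nsub; apply: (maxX X'); first by split.
  by rewrite /= famX'.
have F'F s C : F' s C -> F s C by move=> F'C; left; apply: sub'.
have [cs|ncs] := pselect (cl s0).
  left; apply: F'F; apply: up (fin s0 set0 (finite_set0 _)) => x _.
  by have [Ax|nA] := pselect (A x); [left|right=> ex; apply/nA/ex].
right; apply: F'F; apply: up (fin s0 set0 (finite_set0 _)) => x _.
by have [Ax|nA] := pselect (A x); [right=> -[_ /(_ Ax)]|left].
Qed.

End Families.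

(** * Neighbourhoods and large sets in the remainder *)

Lemma open_stone_basic A : open (stone_basic A).
Proof. by exists [set A] => //; rewrite bigcup_set1. Qed.

Lemma nbhs_stoneP (p : omega_star) (U : set omega_star) :
  nbhs p U <-> exists A, large p A /\ stone_basic A `<=` U.
Proof.
split.
  rewrite nbhsE => -[_ [[D _ <-] [A DA pA]] sU]; exists A; split=> // q qA.
  by apply: sU; exists A.
move=> [A [pA sU]]; rewrite nbhsE; exists (stone_basic A) => //.
by split=> //; exact: open_stone_basic.
Qed.

Lemma nbhs_substoneP (Y : set omega_star) (q : set_type Y)
    (U : set (set_type Y)) :
  nbhs q U <-> exists A,
    large (set_val q) A /\ forall y, large (set_val y) A -> U y.
Proof.
split.
  rewrite nbhsE => -[_ [[O oO <-] Oq] sU].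
  have [A [qA sO]] :=
    (nbhs_stoneP (set_val q) O).1 (open_nbhs_nbhs (conj oO Oq)).
  by exists A; split=> // y /sO /sU.
move=> [A [qA sU]]; rewrite nbhsE; exists (set_val @^-1` stone_basic A).
  by split=> //; exists (stone_basic A) => //; exact: open_stone_basic.
exact: sU.
Qed.

Section StonePoint.
Variable p : omega_star.

Lemma large_filter : ProperFilter (large p).
Proof. by have := large_ultra p => -[]. Qed.

Lemma largeS A C : A `<=` C -> large p A -> large p C.
Proof. by have ? := large_filter; exact: filterS. Qed.

Lemma largeI A C : large p A -> large p C -> large p (A `&` C).
Proof. by have ? := large_filter; exact: filterI. Qed.

Lemma largeN A C : large p A -> large p C -> A `&` C `<=` set0 -> False.
Proof.
have ? := large_filter => pA pC AC; apply: (@filter_not_empty _ (large p)).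
exact: largeS AC (largeI pA pC).
Qed.

Lemma largeC A : large p A \/ large p (~` A).
Proof. exact: in_ultra_setVsetC (large_ultra p). Qed.

Lemma large_bigcap (T : eqType) (l : seq T) (U : T -> set nat) :
  (forall c, c \in l -> large p (U c)) ->
  large p [set x | forall c, c \in l -> U c x].
Proof.
elim: l => [|c l IH] lU.
  by have ? := large_filter; apply: largeS filterT => x _ c.
have lU' d : d \in l -> large p (U d).
  by move=> dl; apply: lU; rewrite inE dl orbT.
have := largeI (lU c (mem_head _ _)) (IH lU').
apply: largeS => x [Ucx Ux] d.
by rewrite inE => /orP[/eqP->|/Ux].
Qed.

Lemma large_cofinite A : finite_set A -> large p (~` A).
Proof.
have co1 x : large p (~` [set x]).
  apply: contrapT => nx.
  have px : large p [set x] by case: (largeC [set x]).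
  suff : (\bigcap_(A in large p) A) x by rewrite large_free.
  move=> C pC; apply: contrapT => nCx.
  by apply: largeN pC px _ => y [Cy yx]; apply: nCx; rewrite -yx.
move=> /finite_fsetP[L ->] /=.
have pL := @large_bigcap _ (finmap.enum_fset L) (fun c => ~` [set c])
  (fun c _ => co1 c).
by apply: largeS pL => x Lx /= xL; exact: (Lx x xL).
Qed.

End StonePoint.

(** * Countable sets off the closure *)

Lemma infinite_fibre (h : branch -> nat) :
  exists k, infinite_set [set c | h c = k].
Proof.
apply: contrapT => /forallNP fin.
have : countable [set: nat -> bool].
  have -> : [set: nat -> bool] = \bigcup_k [set c | h c = k].
    by apply/seteqP; split=> // c _; exists (h c).
  apply: bigcup_countable => // k _; apply: finite_set_countable.
  exact: contrapT (fin k).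
case/countable_injP => e einj.
pose d n := `[< exists c, e c = n /\ ~~ c n >].
have : d (e d) = ~~ d (e d).
  apply/idP/idP => [/asboolP[c [ec cd]]|nd].
    have cE : c = d by apply: einj; rewrite ?inE.
    by rewrite cE in cd.
  by apply/asboolP; exists d.
by case: (d (e d)).
Qed.

(** The key property of a weak P-set. Here D is indexed by an injection f into
    the integers, and V n is the complement of the set W d with f d = n; for n
    outside the range of f it is everything. *)
Lemma settled_separates (P : nat -> omega_star) (D : set omega_star) :
  (forall V, settled V (fun s => large (P s))) ->
  countable D -> (forall d, D d -> ~ closure (range P) d) ->
  exists A, (forall s, large (P s) A) /\ forall d, D d -> ~ large d A.
Proof.
move=> sP /countable_injP[f finj] nclD.
have finj' d e : D d -> D e -> f d = f e -> d = e.
  by move=> Dd De; apply: finj; rewrite inE.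
have /choice[W WP] d : exists W, D d -> large d W /\ forall s, ~ large (P s) W.
  have [Dd|] := pselect (D d); last by exists set0.
  have /existsNP[U /not_implyP[/nbhs_stoneP[A [dA AU]] nU]] := nclD d Dd.
  exists A => _; split=> // s PsA; apply: nU; exists (P s); split.
    by exists s.
  exact: AU.
pose V n := [set x | forall d, D d -> f d = n -> ~ W d x].
have VP n s : large (P s) (V n).
  have [[d [Dd fd]]|nd] := pselect (exists d, D d /\ f d = n).
    have [_ /(_ s) nW] := WP d Dd.
    have [//|] := largeC (P s) (W d); apply: largeS => x nWx e De fe.
    by rewrite (finj' e d De Dd) // fe.
  have ? := large_filter (P s).
  by apply: largeS filterT => x _ d Dd fd; case: nd; exists d.
have meetP n s : large (P s) (meet V n).
  have := @large_bigcap (P s) _ (iota 0 n.+1) V (fun m _ => VP m s).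
  by apply: largeS => x Vx m mn; apply: Vx; rewrite mem_iota.
have [[U [UP link]]|[s [n nV]]] := sP V; last first.
  by exfalso; apply: largeN nV (meetP n s) _ => x [].
apply: contrapT => nA.
have /choice[h hP] c : exists d, D d /\ large d (U c).
  apply: contrapT => nd; apply: nA; exists (U c); split=> // d Dd dU.
  by apply: nd; exists d.
have [k infk] := infinite_fibre (f \o h).
have [fL Lk kL] := infinite_set_fset k.+1 infk.
pose L := finmap.enum_fset fL.
have link_kL := link k L (finmap.fset_uniq fL) kL.
have [c cL] : exists c, c \in L.
  move: kL; rewrite /L; case: (finmap.enum_fset fL) => // c l _.
  by exists c; rewrite mem_head.
have [Dc _] := hP c; have fc : f (h c) = k by exact: Lk.
have hE c' : c' \in L -> h c' = h c.
  move=> c'L; have [Dc' _] := hP c'; apply: finj' => //.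
  by have := Lk c' c'L; rewrite /= fc.
have UL : large (h c) [set x | forall c', c' \in L -> U c' x].
  by apply: large_bigcap => c' c'L; rewrite -(hE c' c'L); case: (hP c').
have [hW _] := WP (h c) Dc.
apply: largeN (largeI UL hW) (large_cofinite (h c) link_kL) _.
move=> x [[Ux Wx]]; apply; split=> // /(_ k (leqnn k)).
by move=> /(_ (h c) Dc fc); apply.
Qed.

(** The sets of the form [set s | large (P s) A] are exactly the clopen sets of
    the countable space, so P is a homeomorphic embedding. *)
Lemma omega_star_embedding : exists (B : set (set nat)) (P : nat -> omega_star),
  [/\ clopen_algebra B, ultradisconnected B,
    forall A, B [set s | large (P s) A],
    forall b, B b -> exists A, forall s, large (P s) A <-> b s &
    forall V, settled V (fun s => large (P s))].
Proof.
have [B [algB udB]] := ultradisconnected_algebra_exists.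
have [F0 [oF0 pF0 sF0]] := settling_family_exists algB.
have [F [[up cap base fin op] pF F0F dec]] := ultra_extension algB udB oF0 pF0.
have filF s : ProperFilter (F s).
  split; first by move=> /pF[].
  split; last by move=> A C; exact: up.
    by have := fin s set0 (finite_set0 _); rewrite setC0.
  exact: cap.
have ultF s : UltraFilter (F s).
  split; first exact: filF.
  move=> G pG FG; apply/seteqP; split=> // A GA.
  have [//|/FG GnA] := dec s A.
  have G0 : G (A `&` ~` A) by exact: filterI.
  by rewrite setICr in G0; case: (@filter_not_empty _ G pG).
have freeF s : \bigcap_(A in F s) A = set0.
  apply/seteqP; split=> // x Fx; have := Fx _ (fin s [set x] (finite_set1 _)).
  exact.
exists B, (fun s => OmegaStar (ultF s) (freeF s)); split=> //=.
- move=> A; apply: udB; first exact: open_in_crowded.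
  have -> : ~` [set s | F s A] = [set s | F s (~` A)].
    apply/seteqP; split=> s /=; first by case: (dec s A).
    move=> FnA FA; have := cap _ _ _ FA FnA.
    by rewrite setICr => /pF[].
  exact: open_in_crowded.
- move=> b Bb; exists (place @^-1` b) => s; split; last exact: base.
  move=> Fb; apply: contrapT => nbs.
  have := cap _ _ _ Fb (base s _ (clopenC algB Bb) nbs).
  by rewrite -preimage_setI setICr preimage_set0 => /pF[].
- by move=> V; apply: settled_sub (sF0 V).
Qed.

(** * Loneliness in the subspace *)

Section Subspace.
Variables (B : set (set nat)) (P : nat -> omega_star) (Y : set omega_star).
Hypothesis algB : clopen_algebra B.
Hypothesis udB : ultradisconnected B.
Hypothesis BP : forall A, B [set s | large (P s) A].
Hypothesis PB : forall b, B b -> exists A, forall s, large (P s) A <-> b s.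
Hypothesis settledP : forall V, settled V (fun s => large (P s)).
Hypothesis YP : forall s, Y (P s).
Hypothesis Y_off_closure : forall y,
  Y y -> ~ range P y -> ~ closure (range P) y.

Lemma embedding_inj : injective P.
Proof.
move=> s t st; apply: contrapT => /(clopen_separated algB)[b [/PB[A Ab] bs]].
by apply; apply/Ab; rewrite -st; apply/Ab.
Qed.

Definition embedded s : set_type Y := SigSub (mem_set (YP s)).

Definition trace (E : set (set_type Y)) : set nat := [set s | E (embedded s)].

(** The members of E off S stay away from S by [settled_separates], so only the
    trace of E on S matters, and S carries the topology of the countable
    space. *)
Lemma limit_point_trace E s : countable E ->
  limit_point E (embedded s) <-> limit_in B (trace E) s.
Proof.
move=> cE; split=> [limE b Bb bs|accE U /nbhs_substoneP[A [sA AU]]].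
  have [A0 [PA0 nA0]] : exists A, (forall s, large (P s) A) /\
      forall d, (set_val @` E `\` range P) d -> ~ large d A.
    apply: settled_separates => //.
      apply: sub_countable (subset_card_le (@subDsetl _ _ _)) _.
      exact: sub_countable (card_image_le _ _) cE.
    move=> d [[e _ <-] nP]; apply: Y_off_closure => //; exact: set_valP.
  have [A Ab] := PB Bb.
  have [|y [ys Ey [yA yA0]]] :=
      limE [set y | large (set_val y) A /\ large (set_val y) A0].
    apply/nbhs_substoneP; exists (A `&` A0); split.
      by apply: largeI; [exact: (Ab s).2|exact: PA0].
    by move=> y yAA; split; apply: largeS yAA => x [].
  have [[t _ ty]|nr] := pselect (range P (set_val y)); last first.
    by case: (nA0 (set_val y)) => //; split=> //; exists y.
  have ey : y = embedded t by apply: val_inj.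
  exists t; split; first by move=> ts; move/eqP: ys; apply; rewrite ey ts.
    by rewrite /trace /= -ey.
  by apply/Ab; rewrite ty.
have [t [ts Et tA]] := accE _ (BP A) sA.
exists (embedded t); split=> //; last exact: AU.
by apply/eqP => /(congr1 set_val) /embedding_inj.
Qed.

Lemma trace_lonely s0 :
  (forall X, relatively_discrete B X -> ~ limit_in B X s0) ->
  lonely (embedded s0).
Proof.
move=> nd; split.
- move=> E cE dE /(limit_point_trace _ cE); apply: nd => s Es accE.
  have : isolated E (embedded s) by rewrite dE.
  move=> [_ [U /nbhs_substoneP[A [sA AU]] UE]].
  have [t [ts Et tA]] := accE _ (BP A) sA.
  have : (U `&` E) (embedded t) by split=> //; exact: AU.
  by rewrite UE => /(congr1 set_val) /embedding_inj.
- have cR : countable (range embedded).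
    exact: sub_countable (card_image_le _ _) _.
  have tR : trace (range embedded) = setT.
    by apply/seteqP; split=> // s _; exists s.
  exists (range embedded); split=> //; last first.
    by apply/(limit_point_trace _ cR); rewrite tR; exact: limit_inT.
  apply/seteqP; split=> // _ [/set_mem[s _ <-]].
  move=> [U /nbhs_substoneP[A [sA AU]] UE].
  have [t [ts _ tA]] := limit_inT algB (BP A) sA.
  have : (U `&` range embedded) (embedded t) by split; [exact: AU|exists t].
  by rewrite UE => /(congr1 set_val) /embedding_inj.
- move=> E E' cE cE' /(limit_point_trace _ cE) aE.
  move=> /(limit_point_trace _ cE') aE'.
  have cI : countable (E `&` E').
    exact: sub_countable (subset_card_le (@subIsetl _ _ _)) cE.
  apply/(limit_point_trace _ cI); exact: limit_in_filter.
Qed.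

End Subspace.

Theorem theorem5p7 :
  exists (S : set omega_star) (p : omega_star),
    [/\ countable S, closure S p &
      exists q : set_type (([set: omega_star] `\` (closure S `\` S)) `|` [set p]),
        lonely q].
Proof.
have [B [P [algB udB BP PB settledP]]] := omega_star_embedding.
have [s0 nd] := nondiscrete_point_exists algB udB.
exists (range P), (P s0); split.
- exact: sub_countable (card_image_le _ _) _.
- by apply: subset_closure; exists s0.
set Y := _ `|` _.
have YP s : Y (P s) by left; split=> // -[_]; apply; exists s.
exists (embedded YP s0); apply: trace_lonely nd => //.
move=> y [[_ nclo]|-> []]; last by exists s0.
by move=> nP cl; apply: nclo.
Qed.
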